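(* Consider a Bayesian model $\{p(\mathbf{y}|\boldsymbol{\theta}),\pi(\boldsymbol{\theta})\}$ whose parameter space is decomposed as $\boldsymbol{\Theta}=\Theta_1\times\cdots\times\Theta_K$ for some integer $K>1$. Given the mean-field variational family $\mathcal{Q}_{\boldsymbol{\theta}}^{MF}$, assume that the coordinate ascent variational inference (CAVI) algorithm is employed to approximate the posterior density $\pi(\boldsymbol{\theta}|\mathbf{y})$. For each $i=1,\dots,K$, define the functional $\mathcal{R}_{-i}:\mathcal{Q}_{\theta_{-i}}^{MF}\to(0,\infty)$ by $$\mathcal{R}_{-i}\{q(\theta_{-i})\}:=\frac{\int\exp\big(\mathbb{E}_{q(\theta_{-i})}[\log\pi(\theta_i|\theta_{-i},\mathbf{y})]\big)\,d\theta_i}{\exp\mathrm{KL}\big(q(\theta_{-i})\,\|\,\pi(\theta_{-i}|\mathbf{y})\big)}.$$ Let $q^*(\theta_{-i})=\prod_{j\neq i}q^*(\theta_j)$ be the product of the current variational factors and let $q^*(\theta_i)$ be the $i$-th variational factor produced from it by the CAVI update. Then the following hold. (a) The number $\mathcal{R}_{-i}\{q^*(\theta_{-i})\}$, which is constant with respect to $q^*(\theta_i)$, lies in $(0,1]$ and satisfies $$\mathcal{R}_{-i}\{q^*(\theta_{-i})\}\cdot q^*(\theta_i)\le\pi(\theta_i|\mathbf{y})\qquad\text{for all }\theta_i\in\Theta_i.$$ (b) The Kullback–Leibler divergence between $q^*(\theta_i)$ and $\pi(\theta_i|\mathbf{y})$ is bounded below by $$\mathrm{KL}\big(q^*(\theta_i)\,\|\,\pi(\theta_i|\mathbf{y})\big)\ge\max\left\{0,\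 \log\left(\int\exp\big(\mathbb{E}_{q^*(\theta_i)}[\log\pi(\theta_{-i}|\theta_i,\mathbf{y})]\big)\,d\theta_{-i}\right)\right\}.$$
   Context: A Bayesian model $\{p(\mathbf{y}|\boldsymbol{\theta}),\pi(\boldsymbol{\theta})\}$ consists of sampling densities $p(\mathbf{y}|\boldsymbol{\theta})$ and a prior density $\pi(\boldsymbol{\theta})$ on $\boldsymbol{\Theta}$, with finite evidence $m(\mathbf{y})=\int p(\mathbf{y}|\boldsymbol{\theta})\pi(\boldsymbol{\theta})\,d\boldsymbol{\theta}$; the posterior density is $\pi(\boldsymbol{\theta}|\mathbf{y})=p(\mathbf{y}|\boldsymbol{\theta})\pi(\boldsymbol{\theta})/m(\mathbf{y})$. Densities are with respect to Lebesgue measure, and $\mathbf{y}$ is fixed. Write $\boldsymbol{\theta}=(\theta_1,\dots,\theta_K)$ with $\theta_i\in\Theta_i$, $\Theta_{-i}=\prod_{j\ne i}\Theta_j$, and $\theta_{-i}=(\theta_j)_{j\neq i}\in\Theta_{-i}$. $\pi(\theta_i|\mathbf{y})$, $\pi(\theta_{-i}|\mathbf{y})$ are the marginals of $\pi(\boldsymbol{\theta}|\mathbf{y})$, and $\pi(\theta_i|\theta_{-i},\mathbf{y})$, $\pi(\theta_{-i}|\theta_i,\mathbf{y})$ the conditional densities, so $\pi(\boldsymbol{\theta}|\mathbf{y})=\pi(\theta_i|\theta_{-i},\mathbf{y})\pi(\theta_{-i}|\mathbf{y})=\pi(\theta_{-i}|\theta_i,\mathbf{y})\pi(\theta_i|\mathbf{y})$;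 the marginal $\pi(\theta_i|\mathbf{y})$ is taken to be $\int\pi(\theta_i|\theta_{-i},\mathbf{y})\pi(\theta_{-i}|\mathbf{y})\,d\theta_{-i}$. $\mathbb{E}_q$ is expectation under the density $q$, and $\mathrm{KL}(q\|p)=\int q\log(q/p)$. $\mathcal{Q}_{\theta_i}^m$ is the set of all marginal densities on $\Theta_i$ (probability densities of $\theta_i$ not involving $\theta_{-i}$). The mean-field variational family is $\mathcal{Q}_{\boldsymbol{\theta}}^{MF}=\{q(\boldsymbol{\theta})=\prod_{i=1}^K q(\theta_i): q(\theta_i)\in\mathcal{Q}_{\theta_i}^m\}$, and $\mathcal{Q}_{\theta_{-i}}^{MF}=\{q(\theta_{-i})=\prod_{j\neq i}q(\theta_j): q(\theta_j)\in\mathcal{Q}_{\theta_j}^m\}$. The CAVI algorithm starts from an arbitrary element $q^*(\theta_1)\cdots q^*(\theta_K)$ of $\mathcal{Q}_{\boldsymbol{\theta}}^{MF}$ and cycles through $i=1,\dots,K$, at the $i$-th step replacing $q^*(\theta_i)$ (the $i$-th variational factor) by $$q^*(\theta_i)=\frac{\exp\big(\mathbb{E}_{q^*(\theta_{-i})}[\log\pi(\theta_i|\theta_{-i},\mathbf{y})]\big)}{\int\exp\big(\mathbb{E}_{q^*(\theta_{-i})}[\log\pi(\theta_i|\theta_{-i},\mathbf{y})]\big)\,d\theta_i},\qquad q^*(\theta_{-i})=\prod_{j\neq i}q^*(\theta_j),$$ where the factors $q^*(\theta_j)$, $j\ne i$, are the most recently updated ones. Standing assumption (implicit in $\mathcal{R}_{-i}$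 taking values in $(0,\infty)$): the expectations appearing are well defined, $\mathrm{KL}(q^*(\theta_{-i})\|\pi(\theta_{-i}|\mathbf{y}))<\infty$, and the normalizing integral $\int\exp(\mathbb{E}_{q^*(\theta_{-i})}[\log\pi(\theta_i|\theta_{-i},\mathbf{y})])\,d\theta_i$ lies in $(0,\infty)$. *)

(* Defs.v *)
From HB Require Import structures.
From mathcomp Require Import all_boot all_order all_algebra.
From mathcomp Require Import all_classical all_reals all_analysis.
From mathcomp Require Import measurable_realfun.

Set Implicit Arguments.
Unset Strict Implicit.
Unset Printing Implicit Defensive.

Import Order.TTheory GRing.Theory Num.Theory.
Import numFieldNormedType.Exports.

Local Open Scope classical_set_scope.
Local Open Scope ring_scope.
Local Open Scope ereal_scope.

Definition dprod d (I : finType) (T : I -> measurableType d) : Type :=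
  forall i, T i.

HB.instance Definition _ d (I : finType) (T : I -> measurableType d) :=
  gen_eqMixin (dprod T).
HB.instance Definition _ d (I : finType) (T : I -> measurableType d) :=
  gen_choiceMixin (dprod T).
HB.instance Definition _ d (I : finType) (T : I -> measurableType d) :=
  isPointed.Build (dprod T) (fun i => point).

Definition dprod_display : measure_display -> measure_display.
Proof. exact. Qed.

Section dprod_measurable.
Context d (I : finType) (T : I -> measurableType d).

Definition dprod_rect : set_system (dprod T) :=
  [set A | exists i, preimage_set_system setT (fun x : dprod T => x i)
                       measurable A].

Let dprod_set0 : <<s dprod_rect >> set0.
Proof. exact: sigma_algebra0. Qed.

Let dprod_setC A : <<s dprod_rect >> A -> <<s dprod_rect >> (~` A).
Proof. exact: sigma_algebraC. Qed.

Let dprod_bigcup (F : _^nat) : (forall i, <<s dprod_rect >> (F i)) ->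
  <<s dprod_rect >> (\bigcup_i (F i)).
Proof. exact: sigma_algebra_bigcup. Qed.

HB.instance Definition _ := @isMeasurable.Build (dprod_display d)
  (dprod T) <<s dprod_rect >> dprod_set0 dprod_setC dprod_bigcup.

Lemma measurable_proj i : measurable_fun setT (fun x : dprod T => x i).
Proof.
by move=> _ A mA; apply: sub_sigma_algebra; exists i; exists A.
Qed.
Arguments measurable_proj : clear implicits.

Lemma measurable_dprodP d' (U : measurableType d') (f : U -> dprod T) :
  (forall i, measurable_fun setT (fun u => f u i)) -> measurable_fun setT f.
Proof.
move=> mf; apply: (@measurability _ _ _ _ setT f dprod_rect) => //.
move=> _ [_ [i [A mA <-] <-]].
by rewrite !setTI; have := mf i measurableT _ mA; rewrite !setTI.
Qed.

Definition box (A : forall i, set (T i)) : set (dprod T) :=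
  [set x | forall i, A i (x i)].

Lemma measurable_box (A : forall i, set (T i)) :
  (forall i, measurable (A i)) -> measurable (box A).
Proof.
move=> mA.
have -> : box A = \bigcap_(i in [set: I]) ((fun x : dprod T => x i) @^-1` A i).
  by apply/seteqP; split=> [x Ax i _|x Ax i]; [exact: Ax|exact: (Ax i)].
apply: fin_bigcap_measurable; first exact: finite_finset.
by move=> i _; have := measurable_proj i measurableT _ (mA i); rewrite setTI.
Qed.

Lemma measurable_dfwith i :
  measurable_fun setT (fun p : dprod T * T i => dfwith p.1 i p.2 : dprod T).
Proof.
apply: measurable_dprodP => j.
have [ij|ij] := eqVneq i j.
  by case: _ / ij; under eq_fun do rewrite dfwithin; exact: measurable_snd.
under eq_fun do rewrite dfwithout//.
exact: (measurableT_comp (measurable_proj j) measurable_fst).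
Qed.

End dprod_measurable.

Section dprod_measure.
Context d (I : finType) (T : I -> measurableType d) (R : realType).
Variable mu : forall i, {sigma_finite_measure set (T i) -> \bar R}.

(* The product measure is obtained from the Dirac measure at a base point by
   replacing each coordinate in turn by an independent one of law mu i; the base
   point plays no role in the end, see [dprod_measure_box]. *)
Section overwrite.
Variables (i : I) (nu : {measure set (dprod T) -> \bar R}).

Definition overwrite : set (dprod T) -> \bar R :=
  pushforward (nu \x mu i)
    (fun p : dprod T * T i => dfwith p.1 i p.2 : dprod T).

Let overwrite0 : overwrite set0 = 0.
Proof. by rewrite /overwrite /pushforward preimage_set0 measure0. Qed.

Let overwrite_ge0 A : 0 <= overwrite A.
Proof. exact: (measure_ge0 (nu \x mu i)). Qed.

Let overwrite_sigma_additive : semi_sigma_additive overwrite.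
Proof.
move=> F mF tF mUF; rewrite /overwrite /pushforward preimage_bigcup.
have mf A : measurable A -> measurable
    ((fun p : dprod T * T i => dfwith p.1 i p.2 : dprod T) @^-1` A).
  by move=> mA; have := @measurable_dfwith _ _ T i measurableT _ mA; rewrite setTI.
apply: (@measure_semi_sigma_additive _ _ _ (nu \x mu i)).
- by move=> n; exact: mf.
- apply/trivIsetP => /= j k _ _ jk; rewrite -preimage_setI.
  by move/trivIsetP : tF => /(_ _ _ _ _ jk) ->//; rewrite preimage_set0.
- by rewrite -preimage_bigcup; exact: mf.
Qed.

HB.instance Definition _ := isMeasure.Build _ _ _ overwrite
  overwrite0 overwrite_ge0 overwrite_sigma_additive.

End overwrite.

Definition dprod_measure_seq (s : seq I) : {measure set (dprod T) -> \bar R} :=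
  foldr (fun i nu => [the {measure set (dprod T) -> \bar R} of overwrite i nu])
    [the {measure set (dprod T) -> \bar R} of dirac (point : dprod T)] s.

Lemma dprod_measure_seq_box (s : seq I) (A : forall i, set (T i)) :
    uniq s -> (forall i, measurable (A i)) ->
    (forall i, i \notin s -> A i = setT) ->
  dprod_measure_seq s (box A) = \prod_(i <- s) mu i (A i).
Proof.
elim: s A => [|i s IH] A /=.
  move=> _ mA AT; rewrite big_nil /= diracE mem_set// => i.
  by rewrite AT.
move=> /andP[si us] mA AT; rewrite big_cons.
pose A' j : set (T j) := if j == i then setT else A j.
have mA' j : measurable (A' j) by rewrite /A'; case: ifP.
have A'T j : j \notin s -> A' j = setT.
  by move=> js; rewrite /A'; case: ifPn => // ji; rewrite AT// inE negb_or ji.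
have boxE : (fun p : dprod T * T i => dfwith p.1 i p.2 : dprod T) @^-1` box A =
    box A' `*` A i.
  apply/seteqP; split=> [[x t] /= Axt|[x t] /= [A'x At] j].
    split => [j|]; last by have := Axt i; rewrite dfwithin.
    rewrite /A'; case: ifPn => // ji.
    by have := Axt j; rewrite dfwithout// eq_sym.
  have [ij|ij] := eqVneq i j; first by case: _ / ij; rewrite dfwithin.
  rewrite dfwithout//; have := A'x j.
  by rewrite /A' eq_sym (negPf ij).
rewrite /overwrite /pushforward boxE product_measure1E//; last first.
  exact: measurable_box.
rewrite IH// muleC; congr (_ * _).
apply: eq_big_seq => j js; rewrite /A'; case: ifP => // /eqP ji.
by rewrite -ji js in si.
Qed.

Definition dprod_measure : set (dprod T) -> \bar R := dprod_measure_seq (enum I).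

HB.instance Definition _ := Measure.on dprod_measure.

Lemma dprod_measure_box (A : forall i, set (T i)) :
    (forall i, measurable (A i)) ->
  dprod_measure (box A) = \prod_i mu i (A i).
Proof.
move=> mA; rewrite /dprod_measure dprod_measure_seq_box ?enum_uniq//.
  by rewrite big_enum.
by move=> i; rewrite mem_enum.
Qed.

Let dprod_measure_sigma_finite : sigma_finite setT dprod_measure.
Proof.
have F_ i : {F : (set (T i))^nat | [/\ setT = \bigcup_n F n,
    nondecreasing_seq F & forall n, measurable (F n) /\ mu i (F n) < +oo]}.
  apply: cid.
  by have /sigma_finiteP[F [TF ndF Foo]] := sigma_finiteT (mu i); exists F.
pose F i := sval (F_ i).
have xF i (x : T i) : {n | F i n x}.
  apply: cid; rewrite /F; case: (F_ i) => /= G [TG _ _].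
  by have : [set: T i] x by []; rewrite TG => -[n _]; exists n.
have ndF i : nondecreasing_seq (F i) by rewrite /F; case: (F_ i) => ? [].
exists (fun n => box (fun i => F i n)).
  apply/seteqP; split=> // x _.
  exists (\max_i sval (xF i (x i)))%N => // i /=.
  move: (svalP (xF i (x i))); apply/subsetPset/ndF.
  exact: (leq_bigmax i).
move=> n.
have mF i : measurable (F i n) /\ mu i (F i n) < +oo.
  by rewrite /F; case: (F_ i) => /= G [_ _ /(_ n)].
split; first by apply: measurable_box => i; have [] := mF i.
rewrite dprod_measure_box; last by move=> i; have [] := mF i.
suff /andP[] : 0 <= \prod_i mu i (F i n) < +oo by [].
apply: (@big_ind _ (fun x : \bar R => 0 <= x < +oo)) => //.
- by rewrite lee01 ltry.
- move=> x y /andP[x0 xoo] /andP[y0 yoo].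
  by rewrite mule_ge0// lte_mul_pinfty// ge0_fin_numE.
- by move=> i _; rewrite measure_ge0; have [] := mF i.
Qed.

HB.instance Definition _ := Measure_isSigmaFinite.Build _ _ _ dprod_measure
  dprod_measure_sigma_finite.

End dprod_measure.

Definition euclid (R : realType) (n : nat) : measurableType _ :=
  dprod (fun _ : 'I_n => measurableTypeR R).

Definition leb (R : realType) (n : nat) :
    {sigma_finite_measure set (euclid R n) -> \bar R} :=
  dprod_measure (fun _ : 'I_n => @lebesgue_measure R).

Definition pspace (R : realType) (I : finType) (dim : I -> nat) :
    measurableType _ :=
  dprod (fun i => euclid R (dim i)).

Definition pleb (R : realType) (I : finType) (dim : I -> nat) :
    {sigma_finite_measure set (pspace R dim) -> \bar R} :=
  dprod_measure (fun i => leb R (dim i)).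

(* All densities take values in \bar R: a marginal density or a coordinate
   update may be infinite at some points.  We rely on the conventions
   0 * +oo = 0 * -oo = 0, 0^-1 = +oo, +oo^-1 = 0 and lne 0 = -oo. *)
Section densities.
Context d (X : measurableType d) (R : realType).
Variable mu : {measure set X -> \bar R}.
Implicit Types (D : set X) (f g p q : X -> \bar R).

Definition is_density D q :=
  [/\ measurable_fun D q, (forall x, D x -> 0 <= q x) &
      \int[mu]_(x in D) q x = 1].

Definition expect D q g := \int[mu]_(x in D) (q x * g x).

(* The integral defining [expect D q g] is not of the form oo - oo. *)
Definition expect_defined D q g :=
  \int[mu]_(x in D) (fun x => q x * g x)^\+ x < +oo \/
  \int[mu]_(x in D) (fun x => q x * g x)^\- x < +oo.

Definition KL D q p := \int[mu]_(x in D) (q x * lne (q x / p x)).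

End densities.

Section mean_field.
Context (R : realType) (I : finType) (dim : I -> nat).
Variable Theta : forall i, set (euclid R (dim i)).
Arguments Theta : clear implicits.

Definition mf_prod (q : forall i, euclid R (dim i) -> \bar R) :
    pspace R dim -> \bar R :=
  fun theta => \prod_i q i (theta i).

(* An element of the mean-field family is represented by its factors. *)
Definition mean_field (q : forall i, euclid R (dim i) -> \bar R) :=
  forall i, is_density (leb R (dim i)) (Theta i) (q i).

End mean_field.

Section blocks.
Context (R : realType) (I : finType) (dim : I -> nat).
Variable Theta : forall i, set (euclid R (dim i)).
Arguments Theta : clear implicits.
Local Notation E i := (euclid R (dim i)).

Definition others (i : I) : finType := {j : I | j != i}.

(* theta_{-i} ranges over [rspace i]; its Lebesgue measure is [rleb i]. *)
Definition rspace (i : I) : measurableType _ :=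
  pspace R (fun j : others i => dim (val j)).

Definition rleb (i : I) : {sigma_finite_measure set (rspace i) -> \bar R} :=
  pleb R (fun j : others i => dim (val j)).

Definition rTheta (i : I) : set (rspace i) :=
  box (fun j : others i => Theta (val j)).
Arguments rTheta : clear implicits.

Definition rest (i : I) (theta : pspace R dim) : rspace i :=
  fun j : others i => theta (val j).
Arguments rest : clear implicits.

Lemma neq_sym_negb (i k : I) : i <> k -> k != i.
Proof. by move=> ik; apply/eqP; exact: nesym. Qed.

(* The inverse of theta |-> (theta_i, theta_{-i}). *)
Definition assemble (i : I) (x : E i) (z : rspace i) : pspace R dim :=
  fun k => match i =P k with
           | ReflectT ik => ecast j (E j) ik x
           | ReflectF ik => z (Sub k (neq_sym_negb ik))
           end.

Arguments assemble {i} x z.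

Lemma assemble_in i (x : E i) (z : rspace i) : assemble x z i = x.
Proof. by rewrite /assemble; case: eqP => // ii; rewrite eq_axiomK. Qed.

Lemma rest_assemble i (x : E i) (z : rspace i) : rest i (assemble x z) = z.
Proof.
apply: functional_extensionality_dep => -[j ji]; rewrite /rest /assemble /=.
case: eqP => [ij|ij]; first by exfalso; rewrite -ij eqxx in ji.
by congr (z (exist _ _ _)); exact: bool_irrelevance.
Qed.

Lemma assemble_rest i (theta : pspace R dim) :
  assemble (theta i) (rest i theta) = theta.
Proof.
apply: functional_extensionality_dep => k; rewrite /assemble /rest.
by case: eqP => [ik|//]; case: _ / ik.
Qed.

Section posterior.
Variables (lik prior : pspace R dim -> \bar R).

Definition evidence := \int[pleb R dim]_(t in box Theta) (lik t * prior t).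

Definition posterior (t : pspace R dim) := lik t * prior t / evidence.

End posterior.

Section conditionals.
Variable post : pspace R dim -> \bar R.

Definition rmarginal (i : I) (z : rspace i) : \bar R :=
  \int[leb R (dim i)]_(x in Theta i) post (assemble x z).
Arguments rmarginal : clear implicits.

(* [is_cond i c]: [c x z] is a version of the conditional density of theta_i
   at x given theta_{-i} = z.  That [c ^~ z] integrates to 1 for almost every z
   with positive marginal density follows from the factorization. *)
Definition is_cond (i : I) (c : E i -> rspace i -> \bar R) :=
  [/\ measurable_fun (Theta i `*` rTheta i) (fun u => c u.1 u.2),
      (forall x z, Theta i x -> rTheta i z -> 0 <= c x z) &
      {ae pleb R dim, forall theta, box Theta theta ->
        post theta = c (theta i) (rest i theta) * rmarginal i (rest i theta)}].

(* The marginal density of theta_i, computed from the chosen version of the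
   conditional density, so that it has a definite value at every point. *)
Definition marginal (i : I) (c : E i -> rspace i -> \bar R) (x : E i) : \bar R :=
  \int[rleb i]_(z in rTheta i) (c x z * rmarginal i z).
Arguments marginal : clear implicits.

(* [is_rcond c r]: [r x z] is a version of the conditional density of theta_{-i}
   at z given theta_i = x. *)
Definition is_rcond (i : I) (c r : E i -> rspace i -> \bar R) :=
  [/\ measurable_fun (Theta i `*` rTheta i) (fun u => r u.1 u.2),
      (forall x z, Theta i x -> rTheta i z -> 0 <= r x z) &
      {ae pleb R dim, forall theta, box Theta theta ->
        post theta = r (theta i) (rest i theta) * marginal i c (theta i)}].

End conditionals.
Arguments rmarginal : clear implicits.

Section cavi.
Variables (post : pspace R dim -> \bar R).
Variables (c : forall i, E i -> rspace i -> \bar R).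
Arguments c : clear implicits.

Definition cavi_kernel (i : I) (q : rspace i -> \bar R) (x : E i) : \bar R :=
  expeR (expect (rleb i) (rTheta i) q (fun z => lne (c i x z))).
Arguments cavi_kernel : clear implicits.

Definition cavi_norm (i : I) (q : rspace i -> \bar R) : \bar R :=
  \int[leb R (dim i)]_(x in Theta i) cavi_kernel i q x.
Arguments cavi_norm : clear implicits.

Definition rfactors (q : forall i, E i -> \bar R) (i : I) :
    rspace i -> \bar R :=
  mf_prod (fun j : others i => q (val j)).
Arguments rfactors : clear implicits.

Definition cavi_update (i : I) (q : forall i, E i -> \bar R) :
    forall i, E i -> \bar R :=
  dfwith q i
    (fun x => cavi_kernel i (rfactors q i) x / cavi_norm i (rfactors q i)).

Definition Rfun (i : I) (q : rspace i -> \bar R) : \bar R :=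
  cavi_norm i q / expeR (KL (rleb i) (rTheta i) q (rmarginal post i)).

Definition cavi_wf (i : I) (q : rspace i -> \bar R) :=
  [/\ (forall x, Theta i x ->
         expect_defined (rleb i) (rTheta i) q (fun z => lne (c i x z))),
      KL (rleb i) (rTheta i) q (rmarginal post i) < +oo &
      0 < cavi_norm i q < +oo].

End cavi.

End blocks.

Arguments rTheta {R I dim} Theta i.
Arguments rmarginal {R I dim} Theta post i z.
Arguments marginal {R I dim} Theta post i c x.
Arguments is_cond {R I dim} Theta post i c.
Arguments is_rcond {R I dim} Theta post i c r.
Arguments cavi_kernel {R I dim} Theta c i q x.
Arguments cavi_norm {R I dim} Theta c i q.
Arguments rfactors {R I dim} q i.
Arguments cavi_update {R I dim} Theta c i q.
Arguments Rfun {R I dim} Theta post c i q.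
Arguments cavi_wf {R I dim} Theta post c i q.

(* The likelihood [lik y t] is the sampling density p(y|t); [prior] may be
   improper, as only the evidence of the observed [y] has to be finite. *)
Definition bayes_model (R : realType) (I : finType) (dim : I -> nat)
    (Theta : forall i, set (euclid R (dim i))) (n : nat)
    (lik : euclid R n -> pspace R dim -> \bar R)
    (prior : pspace R dim -> \bar R) (y : euclid R n) :=
  [/\ (forall t, box Theta t -> is_density (leb R n) setT (lik ^~ t)),
      measurable_fun (box Theta) (lik y),
      measurable_fun (box Theta) prior,
      (forall t, box Theta t -> 0 <= prior t) &
      0 < evidence Theta (lik y) prior < +oo].

(* [q t] gives the variational factors after t coordinate updates; the update
   turning [q t] into [q t.+1] acts on coordinate t mod K. *)
Definition cavi_run (R : realType) (K : nat) (dim : 'I_K -> nat)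
    (Theta : forall i, set (euclid R (dim i)))
    (c : forall i, euclid R (dim i) -> rspace R dim i -> \bar R)
    (q : nat -> forall i, euclid R (dim i) -> \bar R) :=
  mean_field Theta (q 0%N) /\
  (forall (t : nat) (i : 'I_K), i = (t %% K)%N :> nat ->
     q t.+1 = cavi_update Theta c i (q t)).

(* Main.v *)
Require Import Defs.
From HB Require Import structures.
From mathcomp Require Import all_boot all_order all_algebra.
From mathcomp Require Import all_classical all_reals all_analysis.
From mathcomp Require Import measurable_realfun.
From mathcomp Require Import ring lra.

Set Implicit Arguments.
Unset Strict Implicit.
Unset Printing Implicit Defensive.

Import Order.TTheory GRing.Theory Num.Theory.
Import numFieldNormedType.Exports.

Local Open Scope classical_set_scope.
Local Open Scope ring_scope.
Local Open Scope ereal_scope.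

(* For densities q and p and a function f >= 0, integrating
   q log f <= q log (q/p) + (log s - 1) q + f p / s, which is log u <= u - 1 at
   u = f p / (q s), and choosing s well gives the Donsker-Varadhan type bound
   exp (E_q [log f]) / exp (KL (q || p)) <= \int f p.  For f = pi(theta_i | .) and
   p = pi(theta_{-i} | y) this is the pointwise inequality of (a); integrating it
   in theta_i gives R_{-i} <= 1.  With the two blocks exchanged, the same
   integrated bound is (b).  The product structure enters through the fact that
   Lebesgue measure on the whole space is the image of the product of the Lebesgue
   measures of the blocks theta_i and theta_{-i}. *)

(** * Pointwise inequalities for the extended logarithm *)

Section logarithms.
Context (R : realType).
Implicit Types (a b f : \bar R).

(** Open rays are pulled back to open rays, which gives the measurability of [lne]. Nonpositive [a]
    fit in because then [lne a = -oo], while [expR s > 0]. *)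
Lemma lt_EFin_lne (s : R) a : (s%:E < lne a) = ((expR s)%:E < a).
Proof.
case: a => [x| |] //=; last by rewrite !ltry.
case: ifPn => [x0|]; last first.
  by rewrite -ltNge => x0; rewrite !lte_fin -{2}(lnK x0) ltr_expR.
rewrite [RHS]lte_fin; apply/esym/negbTE.
by rewrite -leNgt (le_trans x0)// expR_ge0.
Qed.

Lemma ln_le_subr1 (u : R) : (0 < u)%R -> (ln u <= u - 1)%R.
Proof.
move=> u0; have := @le_ln1Dx R (u - 1)%R; rewrite (addrC 1%R) subrK; apply.
by lra.
Qed.

(** This is log u <= u - 1 at u = b / a. For two densities the lower bound [a - b] integrates to 0,
    which yields Gibbs' inequality. *)
Lemma kl_integrand_ge a b : 0 <= a -> 0 <= b ->
  a \is a fin_num -> b \is a fin_num -> a - b <= a * lne (a / b).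
Proof.
case: a => [a| |]// + + _; case: b => [b| |]// + + _; rewrite !lee_fin => a0 b0.
have [->|a_neq0] := eqVneq a 0%R; first by rewrite !mul0e sub0e leeNl oppe0 lee_fin.
have {}a0 : (0 < a)%R by rewrite lt_neqAle eq_sym a_neq0.
(* Here [a > 0], and the convention 0^-1 = +oo makes the right-hand side infinite. *)
have [->|b_neq0] := eqVneq b 0%R.
  by rewrite inve0 gt0_muley ?lte_fin// gt0_muley ?lte_fin// leey.
have {}b0 : (0 < b)%R by rewrite lt_neqAle eq_sym b_neq0.
rewrite inver (negPf b_neq0) -EFinM lne_EFin ?divr_gt0//= -EFinM -EFinB lee_fin.
have ba0 : (0 < b / a)%R by rewrite divr_gt0.
have : (a * ln (b / a) <= a * (b / a - 1))%R by rewrite ler_pM2l// ln_le_subr1.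
have -> : (a * (b / a - 1) = b - a)%R by field.
by rewrite -[X in ln X]invf_div lnV ?posrE ?divr_gt0// mulrN; lra.
Qed.

(** The last two finiteness hypotheses exclude the degenerate cases: [a > 0] with [b = 0] would make
    [a * lne (a / b)] infinite, and [f = +oo] with [b > 0] would make [f * b] infinite. *)
Lemma mule_lne_le a b f (s : R) : (0 < s)%R -> 0 <= a -> 0 <= b -> 0 <= f ->
    a \is a fin_num -> b \is a fin_num -> f * b \is a fin_num ->
    a * lne (a / b) \is a fin_num ->
  a * lne f <= a * lne (a / b) + (ln s - 1)%:E * a + s^-1%:E * (f * b).
Proof.
case: a => [a| |]// s0 + + + _; case: b => [b| |]// + + + _.
rewrite !lee_fin => a0 b0 f0 fb H.
have [->|a_neq0] := eqVneq a 0%R.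
  rewrite !(mul0e, mule0, add0e); apply: mule_ge0; last exact: mule_ge0.
  by rewrite lee_fin invr_ge0 ltW.
have {}a0 : (0 < a)%R by rewrite lt_neqAle eq_sym a_neq0.
have [b_eq0|b_neq0] := eqVneq b 0%R.
  by move: H; rewrite b_eq0 inve0 gt0_muley ?lte_fin// gt0_muley ?lte_fin.
have {}b0 : (0 < b)%R by rewrite lt_neqAle eq_sym b_neq0.
move: f f0 fb {H} => [f| |]//; last by rewrite gt0_mulye ?lte_fin.
rewrite !lee_fin => f0 _.
rewrite inver (negPf b_neq0) -EFinM (@lne_EFin _ (a / b)%R) ?divr_gt0//.
(* At [f = 0] the left-hand side is [-oo], since [a > 0]. *)
have [->|f_neq0] := eqVneq f 0%R.
  by rewrite /= lexx gt0_muleNy ?lte_fin// leNye.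
have {}f0 : (0 < f)%R by rewrite lt_neqAle eq_sym f_neq0.
rewrite lne_EFin// -!(EFinM, EFinD) lee_fin.
have u0 : (0 < f * b / (a * s))%R by rewrite divr_gt0// mulr_gt0.
have : (a * ln (f * b / (a * s)) <= a * (f * b / (a * s) - 1))%R.
  by rewrite ler_pM2l// ln_le_subr1.
rewrite !ln_div ?posrE ?mulr_gt0// !lnM ?posrE//.
have -> : (a * (f * b / (a * s) - 1) = s^-1 * (f * b) - a)%R.
  by field; rewrite a_neq0 gt_eqF.
by lra.
Qed.

End logarithms.

(** * Measurability of extended functions and comparison of integrals *)

Section measurability.
Context d (T : measurableType d) (R : realType).
Implicit Types (D : set T) (f g : T -> \bar R).

Lemma measurable_fun_lne D f :
  measurable_fun D f -> measurable_fun D (fun x => lne (f x)).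
Proof.
move=> mf mD; apply: (measurability _ (ErealGenOInfty.measurableE R)) => //.
move=> _ [_ [s ->] <-].
rewrite (_ : _ @^-1` _ = f @^-1` `](expR s)%:E, +oo[).
  by apply: mf => //; exact: emeasurable_itv.
by rewrite !preimage_itvoy; apply/seteqP; split => x /=; rewrite lt_EFin_lne.
Qed.

Lemma measurable_fun_expeR D f :
  measurable_fun D f -> measurable_fun D (fun x => expeR (f x)).
Proof.
move=> mf mD; apply: (measurability _ (ErealGenOInfty.measurableE R)) => //.
move=> _ [_ [s ->] <-]; rewrite preimage_itvoy.
have [s0|s0] := ltP s 0%R.
  rewrite (_ : [set _ | _] = setT) ?setIT//.
  apply/seteqP; split => x //= _.
  by rewrite (@lt_le_trans _ _ 0)// expeR_ge0.
(* At [s = 0] the ray starts at [lne 0 = -oo], as it should: [expeR] vanishes only at [-oo]. *)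
rewrite (_ : [set _ | _] = f @^-1` `]lne s%:E, +oo[).
  by apply: mf => //; exact: emeasurable_itv.
rewrite preimage_itvoy; apply/seteqP; split => x /=;
  by rewrite -[X in X < expeR _]lneK ?lte_expeR// in_itv /= lee_fin s0 leey.
Qed.

(** Inversion reverses the order on [0, +oo], endpoints included since 0^-1 = +oo and +oo^-1 = 0, so
    rays are pulled back to rays. *)
Lemma measurable_fun_inve D f : (forall x, D x -> 0 <= f x) ->
  measurable_fun D f -> measurable_fun D (fun x => (f x)^-1).
Proof.
move=> f0 mf mD; apply: (measurability _ (ErealGenOInfty.measurableE R)) => //.
move=> _ [_ [s ->] <-]; rewrite preimage_itvoy.
have [s0|s0] := ltP s 0%R.
  rewrite (_ : _ `&` _ = D)//; apply/seteqP; split => [x []//|x Dx]; split => //=.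
  by rewrite (@lt_le_trans _ _ 0)// inve_ge0 f0.
rewrite (_ : _ `&` _ = D `&` f @^-1` `]-oo, (s%:E)^-1[).
  by apply: mf => //; exact: emeasurable_itv.
rewrite preimage_itvNyo; apply/seteqP; split => x [Dx] /=;
  by rewrite inve_pgt ?inE ?lee_fin ?f0.
Qed.

(** Positive and negative parts are compared separately and recombined by monotonicity of addition,
    so integrands of either sign and infinite integrals are covered. *)
Lemma le_integral_ae (mu : {measure set T -> \bar R}) D f g : measurable D ->
    measurable_fun D f -> measurable_fun D g ->
    {ae mu, forall x, D x -> f x <= g x} ->
  \int[mu]_(x in D) f x <= \int[mu]_(x in D) g x.
Proof.
move=> mD mf mg fg; rewrite [leLHS]integralE [leRHS]integralE.
apply: leeB; apply: ae_ge0_le_integral => //.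
- exact: measurable_funepos.
- exact: measurable_funepos.
- apply: filterS fg => x /[apply] fgx.
  by rewrite !funeposE ge_max !le_max fgx lexx orbT.
- exact: measurable_funeneg.
- exact: measurable_funeneg.
- apply: filterS fg => x /[apply] fgx.
  by rewrite !funenegE ge_max !le_max lexx orbT leeN2 fgx.
Qed.

(** A difference of extended reals is finite only when both terms are, so both the positive and the
    negative part have finite integral. *)
Lemma integrable_fin_integral (mu : {measure set T -> \bar R}) D f :
    measurable D -> measurable_fun D f ->
  \int[mu]_(x in D) f x \is a fin_num -> mu.-integrable D f.
Proof.
move=> mD mf; rewrite integralE fin_numB => /andP[fp fn].
apply/integrableP; split => //.
under eq_integral do rewrite -[`|f _|]/((abse \o f) _) fune_abse.
rewrite ge0_integralD//; [|exact: measurable_funepos|exact: measurable_funeneg].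
by rewrite lte_add_pinfty// ltey_eq ?fp ?fn.
Qed.

Lemma ge0_integrable_lty (mu : {measure set T -> \bar R}) D f :
    measurable D -> measurable_fun D f -> (forall x, D x -> 0 <= f x) ->
  \int[mu]_(x in D) f x < +oo -> mu.-integrable D f.
Proof.
move=> mD mf f0 foo; apply: integrable_fin_integral => //.
by rewrite ge0_fin_numE// integral_ge0.
Qed.

End measurability.

(** * Gibbs' inequality and the Donsker-Varadhan type bound *)

Section gibbs.
Context d (T : measurableType d) (R : realType).
Variables (mu : {measure set T -> \bar R}) (D : set T).
Hypothesis mD : measurable D.
Implicit Types (f p q : T -> \bar R).

Lemma measurable_kl_integrand q p : is_density mu D q -> is_density mu D p ->
  measurable_fun D (fun x => q x * lne (q x / p x)).
Proof.
move=> [mq _ _] [mp p0 _]; apply: emeasurable_funM => //.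
apply: measurable_fun_lne; apply: emeasurable_funM => //.
exact: measurable_fun_inve.
Qed.

Lemma density_integrable q : is_density mu D q -> mu.-integrable D q.
Proof.
by move=> [mq q0 q1]; apply: ge0_integrable_lty => //; rewrite q1 ltry.
Qed.

(** Gibbs' inequality: the integrand dominates [q - p], whose integral is 1 - 1 = 0. *)
Lemma KL_ge0 q p : is_density mu D q -> is_density mu D p -> 0 <= KL mu D q p.
Proof.
move=> dq dp; have iq := density_integrable dq; have ip := density_integrable dp.
have [mq q0 q1] := dq; have [mp p0 p1] := dp.
have -> : 0 = \int[mu]_(x in D) (q x - p x).
  by rewrite integralB// q1 p1 subee.
apply: le_integral_ae => //.
- exact: emeasurable_funB.
- exact: measurable_kl_integrand.
(* Integrable functions are finite almost everywhere, and there the pointwise bound applies. *)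
- have qfin := integrable_ae mD iq; have pfin := integrable_ae mD ip.
  apply: filterS2 qfin pfin => x qx px Dx.
  by apply: kl_integrand_ge; [exact: q0|exact: p0|exact: qx|exact: px].
Qed.

(* The proof takes s = exp (E_q [log f] - KL (q || p)). *)
Lemma expeR_expect_le q p f : is_density mu D q -> is_density mu D p ->
    measurable_fun D f -> (forall x, D x -> 0 <= f x) ->
    KL mu D q p < +oo ->
  expeR (expect mu D q (fun x => lne (f x))) / expeR (KL mu D q p) <=
    \int[mu]_(x in D) (f x * p x).
Proof.
move=> dq dp mf f0 kloo.
have [mq q0 q1] := dq; have [mp p0 p1] := dp.
have iq := density_integrable dq; have ip := density_integrable dp.
have klfin : KL mu D q p \is a fin_num by rewrite ge0_fin_numE// KL_ge0.
have ikl := integrable_fin_integral mD (measurable_kl_integrand dq dp) klfin.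
have M0 : 0 <= \int[mu]_(x in D) (f x * p x).
  by apply: integral_ge0 => x Dx; rewrite mule_ge0 ?f0 ?p0.
have mfp : measurable_fun D (fun x => f x * p x) by exact: emeasurable_funM.
have [->|Mfin] := eqVneq (\int[mu]_(x in D) (f x * p x)) +oo; first exact: leey.
have {}Mfin : \int[mu]_(x in D) (f x * p x) \is a fin_num.
  by rewrite ge0_fin_numE// lt_neqAle Mfin leey.
have ifp := integrable_fin_integral mD mfp Mfin.
(* This integrates [mule_lne_le]; the middle term becomes a constant because [q] has integral 1. *)
have bound (s : R) : (0 < s)%R ->
  expect mu D q (fun x => lne (f x)) <=
    KL mu D q p + (ln s - 1)%:E + s^-1%:E * \int[mu]_(x in D) (f x * p x).
  move=> s0.
  have -> : (ln s - 1)%:E = \int[mu]_(x in D) ((ln s - 1)%:E * q x).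
    by rewrite integralZl// q1 mule1.
  have isq : mu.-integrable D (fun x => (ln s - 1)%:E * q x).
    exact: integrableZl.
  have isfp : mu.-integrable D (fun x => s^-1%:E * (f x * p x)).
    exact: integrableZl.
  have iklsq : mu.-integrable D
      (fun x => q x * lne (q x / p x) + (ln s - 1)%:E * q x).
    exact: integrableD.
  rewrite -integralZl// /KL -[X in X + _]integralD// -integralD//.
  apply: le_integral_ae => //.
  - by apply: emeasurable_funM => //; exact: measurable_fun_lne.
  - by apply: measurable_int; apply: integrableD isfp.
  - have qfin := integrable_ae mD iq; have pfin := integrable_ae mD ip.
    have fpfin := integrable_ae mD ifp; have klf := integrable_ae mD ikl.
    apply: filterS2 (filterI qfin pfin) (filterI fpfin klf).
    move=> x [qx px] [fpx klx] Dx.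
    by apply: mule_lne_le => //; [exact: q0|exact: p0|exact: f0|exact: qx|
      exact: px|exact: fpx|exact: klx].
move: klfin Mfin M0 bound; set M := \int[mu]_(x in D) _.
case: (KL _ _ _ _) => [k| |]// _; case: M => [M| |]// _ M0 bound.
case: (expect _ _ _ _) bound => [e| |] bound; last by rewrite /= mul0e.
(* The bound now reads e <= e - 1 + M / s, hence s <= M, where s = exp e / exp k. *)
- have := bound _ (expR_gt0 (e - k)); rewrite expRK -EFinM -!EFinD !lee_fin.
  move=> eM; rewrite inver gt_eqF ?expR_gt0//= -EFinM lee_fin -expRB.
  have : (1 <= (expR (e - k))^-1 * M)%R by lra.
  by rewrite mulrC ler_pdivlMr ?expR_gt0// mul1r.
(* At s = 1 the bound has a finite right-hand side, so the expectation cannot be [+oo]. *)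
- by have := bound _ ltr01; rewrite -EFinM -!EFinD.
Qed.

End gibbs.

(** * Tonelli's theorem on rectangles *)

Section tonelli.
Context d1 d2 (X : measurableType d1) (Y : measurableType d2) (R : realType).
Variables (m1 : {sigma_finite_measure set X -> \bar R}).
Variables (m2 : {sigma_finite_measure set Y -> \bar R}).
Variables (D : set X) (D' : set Y).
Hypotheses (mD : measurable D) (mD' : measurable D').
Variable f : X -> Y -> \bar R.
Hypothesis mf : measurable_fun (D `*` D') (fun u => f u.1 u.2).

Let mDD' : measurable (D `*` D'). Proof. exact: measurableX. Qed.

(** Extension by zero off the rectangle reduces integrals over [D] and [D'] to integrals over the
    whole spaces. *)
Let fDD' (g : X -> Y -> \bar R) := (fun u => g u.1 u.2) \_ (D `*` D').

Let fDD'E g x y : fDD' g (x, y) = (g x \_ D') y *+ (x \in D).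
Proof.
rewrite /fDD' !patchE in_setX; case: (x \in D) => //=.
Qed.

Let integral_fDD' g x : \int[m2]_y fDD' g (x, y) =
  ((fun x => \int[m2]_(y in D') g x y) \_ D) x.
Proof.
rewrite [RHS]patchE; case: ifPn => xD.
  by rewrite [RHS]integral_mkcond; apply: eq_integral => y _; rewrite fDD'E xD.
by apply: integral0_eq => y _; rewrite fDD'E (negPf xD).
Qed.

Lemma measurable_fun_section x : D x -> measurable_fun D' (f x).
Proof.
move=> Dx; apply/(measurable_restrictT _ mD').
have /(measurable_restrictT _ mDD') mf' := mf.
have := measurableT_comp mf' (pair1_measurable x).
apply: eq_measurable_fun => y _ /=.
by have := fDD'E f x y; rewrite /fDD' mem_set.
Qed.

Let ge0_measurable_integral (g : X -> Y -> \bar R) :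
    measurable_fun (D `*` D') (fun u => g u.1 u.2) ->
    (forall x y, D x -> D' y -> 0 <= g x y) ->
  measurable_fun D (fun x => \int[m2]_(y in D') g x y).
Proof.
move=> mg g0; apply/(measurable_restrictT _ mD).
have /(measurable_restrictT _ mDD') mg' := mg.
rewrite (_ : _ \_ _ = fun x => \int[m2]_y fDD' g (x, y)); last first.
  by apply/funext => x; rewrite integral_fDD'.
apply: (measurable_fun_fubini_tonelli_F (fDD' g)) => // u.
rewrite /fDD' patchE; case: ifPn => //.
by rewrite in_setE => -[Dx Dy]; exact: g0.
Qed.

(** The sign of [f] is arbitrary, for the sake of integrands such as [q y * lne (c x y)]; Tonelli is
    applied to the positive and negative parts. *)
Lemma measurable_fun_integral :
  measurable_fun D (fun x => \int[m2]_(y in D') f x y).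
Proof.
under eq_fun do rewrite integralE.
apply: emeasurable_funB; apply: ge0_measurable_integral => //.
- rewrite (_ : (fun u => _) = (fun u => f u.1 u.2)^\+).
    exact: measurable_funepos.
  by apply/funext => u; rewrite !funeposE.
- rewrite (_ : (fun u => _) = (fun u => f u.1 u.2)^\-).
    exact: measurable_funeneg.
  by apply/funext => u; rewrite !funenegE.
Qed.

Hypothesis f0 : forall x y, D x -> D' y -> 0 <= f x y.

Let mfDD' : measurable_fun setT (fDD' f).
Proof. exact/(measurable_restrictT _ mDD'). Qed.

Let fDD'_ge0 u : 0 <= fDD' f u.
Proof.
by rewrite /fDD' patchE; case: ifPn => //; rewrite in_setE => -[Dx Dy]; exact: f0.
Qed.

Lemma integral_prod1 : \int[m1 \x m2]_(u in D `*` D') f u.1 u.2 =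
  \int[m1]_(x in D) \int[m2]_(y in D') f x y.
Proof.
rewrite integral_mkcond [LHS](fubini_tonelli1 (fDD' f))// [RHS]integral_mkcond.
by apply: eq_integral => x _; rewrite /fubini_F integral_fDD'.
Qed.

Lemma exchange_integral_setX : \int[m1]_(x in D) \int[m2]_(y in D') f x y =
  \int[m2]_(y in D') \int[m1]_(x in D) f x y.
Proof.
rewrite [LHS]integral_mkcond [RHS]integral_mkcond.
under eq_integral do rewrite -integral_fDD'.
rewrite (fubini_tonelli (fDD' f))//; apply: eq_integral => y _.
rewrite [RHS]patchE; case: ifPn => yD'.
  rewrite [RHS]integral_mkcond; apply: eq_integral => x _.
  by rewrite fDD'E !patchE yD'; case: (x \in D).
apply: integral0_eq => x _; rewrite fDD'E patchE (negPf yD').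
by case: (x \in D).
Qed.

End tonelli.

(** This lets the two blocks of variables exchange roles. *)
Lemma measurable_fun_uncurry_swap d1 d2 d3 (X : measurableType d1)
    (Y : measurableType d2) (Z : measurableType d3) (D : set X) (D' : set Y)
    (f : X -> Y -> Z) : measurable D -> measurable D' ->
  measurable_fun (D `*` D') (fun u => f u.1 u.2) ->
  measurable_fun (D' `*` D) (fun u => f u.2 u.1).
Proof.
move=> mD mD' mf.
have -> : (fun u : Y * X => f u.2 u.1) =
    (fun u => f u.1 u.2) \o (fun u => (u.2, u.1)) by [].
apply: (measurable_comp (F := D `*` D')) => //.
- exact: measurableX.
- by move=> _ [[y x] [D'y Dx]] <-.
- by apply: measurable_funTS; exact: measurable_fun_pair.
Qed.

(** * Finite product measures: uniqueness and integrals of products *)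

Section dprod_measure_theory.
Context d (I : finType) (T : I -> measurableType d) (R : realType).
Variable mu : forall i, {sigma_finite_measure set (T i) -> \bar R}.

Lemma sigma_finite_boxes : exists F : forall i, (set (T i))^nat,
  (forall i n, measurable (F i n) /\ mu i (F i n) < +oo) /\
  forall x : dprod T, exists n, forall i, F i n (x i).
Proof.
have F_ i : {F : (set (T i))^nat | [/\ setT = \bigcup_n F n,
    nondecreasing_seq F & forall n, measurable (F n) /\ mu i (F n) < +oo]}.
  apply: cid.
  by have /sigma_finiteP[F [TF ndF Foo]] := sigma_finiteT (mu i); exists F.
exists (fun i => sval (F_ i)); split => [i n|x].
  by case: (F_ i) => /= F [_ _ /(_ n)].
have xF i : {n | sval (F_ i) n (x i)}.
  apply: cid; case: (F_ i) => /= F [TF _ _].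
  by have : [set: T i] (x i) by []; rewrite TF => -[n _]; exists n.
(* The exhausting sequences are nondecreasing and [I] is finite, so the largest of the individual
   indices serves all coordinates. *)
exists (\max_i sval (xF i))%N => i.
move: (svalP (xF i)) (@leq_bigmax _ (fun i => sval (xF i)) i).
move: (sval (xF i)) => n; case: (F_ i) => /= F [_ ndF _] Fx nle.
by move: Fx; exact/subsetPset/ndF.
Qed.

(** Boxes are stable under intersection and generate the sigma-algebra, and countably many boxes of
    finite measure cover the space, so the values on boxes determine the measure. *)
Lemma dprod_measure_unique (nu : {measure set (dprod T) -> \bar R}) :
    (forall A : forall i, set (T i), (forall i, measurable (A i)) ->
       nu (box A) = \prod_i mu i (A i)) ->
  forall B, measurable B -> dprod_measure mu B = nu B.
Proof.
move=> nuE; have [F [mF xF]] := sigma_finite_boxes.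
pose G := [set B | exists2 A : forall i, set (T i),
  (forall i, measurable (A i)) & B = box A].
apply: (measure_unique G (fun n => box (fun i => F i n))) => //.
- apply/seteqP; split; last first.
    apply: smallest_sub; first exact: sigma_algebra_measurable.
    by move=> _ [A mA ->]; exact: measurable_box.
  apply: sub_sigma_algebra2 => _ [i [A mA <-]].
  (* A cylinder over coordinate [i] is the box whose other sides are full. *)
  exists (dfwith (fun j => [set: T j]) i A).
    move=> j; have [ij|ij] := eqVneq i j; last by rewrite dfwithout.
    by case: _ / ij; rewrite dfwithin.
  rewrite setTI; apply/seteqP; split => x /=.
    move=> Ax j; have [ij|ij] := eqVneq i j; last by rewrite dfwithout.
    by case: _ / ij; rewrite dfwithin.
  by move=> /(_ i); rewrite dfwithin.
- move=> _ _ [A mA ->] [B mB ->]; exists (fun i => A i `&` B i).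
    by move=> i; exact: measurableI.
  apply/seteqP; split => x /=; first by move=> [Ax Bx] i; split.
  by move=> ABx; split => i; have [] := ABx i.
- by move=> n; exists (fun i => F i n) => // i; have [] := mF i n.
- by apply/seteqP; split => // x _; have [n Fx] := xF x; exists n.
- by move=> _ [A mA ->]; rewrite nuE// -dprod_measure_box.
- move=> n; rewrite [X in X < _]dprod_measure_box; last by move=> i; have [] := mF i n.
  suff /andP[] : 0 <= \prod_i mu i (F i n) < +oo by [].
  apply: (@big_ind _ (fun x : \bar R => 0 <= x < +oo)) => //.
  + by rewrite lee01 ltry.
  + move=> x y /andP[x0 xoo] /andP[y0 yoo].
    by rewrite mule_ge0// lte_mul_pinfty// ge0_fin_numE.
  + by move=> i _; rewrite measure_ge0; have [] := mF i n.
Qed.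

(** Fubini is applied at each stage of the construction. Coordinates outside [s] still carry the
    Dirac mass at the base point, so full sides there keep the measure finite. *)
Lemma sigma_finite_dprod_measure_seq (s : seq I) : uniq s ->
  sigma_finite setT (dprod_measure_seq mu s).
Proof.
move=> us; have [F [mF xF]] := sigma_finite_boxes.
pose A n i := if i \in s then F i n else setT.
have mA n i : measurable (A n i).
  by rewrite /A; case: ifP => // _; have [] := mF i n.
exists (fun n => box (A n)).
  apply/seteqP; split => // x _; have [n Fx] := xF x; exists n => // i.
  by rewrite /A; case: ifP.
move=> n; split; first exact: measurable_box.
rewrite dprod_measure_seq_box//; last by move=> i /negPf; rewrite /A => ->.
rewrite big_seq_cond.
suff /andP[] : 0 <= \prod_(i <- s | (i \in s) && true) mu i (A n i) < +oo by [].
apply: (@big_ind _ (fun x : \bar R => 0 <= x < +oo)) => //.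
- by rewrite lee01 ltry.
- move=> x y /andP[x0 xoo] /andP[y0 yoo].
  by rewrite mule_ge0// lte_mul_pinfty// ge0_fin_numE.
- by move=> i; rewrite andbT measure_ge0 /A => ->; have [] := mF i n.
Qed.

Lemma measurable_prode d' (U : measurableType d') (D : set U) (J : Type)
    (s : seq J) (f : J -> U -> \bar R) :
  (forall j, measurable_fun D (f j)) ->
  measurable_fun D (fun x => \prod_(j <- s) f j x).
Proof.
move=> mf; elim: s => [|j s IH].
  by under eq_fun do rewrite big_nil; exact: measurable_cst.
by under eq_fun do rewrite big_cons; exact: emeasurable_funM.
Qed.

Section integral_prod.
Variable f : forall i, T i -> \bar R.
Arguments f : clear implicits.
Hypotheses (mf : forall i, measurable_fun setT (f i)).
Hypotheses (f0 : forall i x, 0 <= f i x).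

Let mprod (s : seq I) :
  measurable_fun setT (fun x : dprod T => \prod_(i <- s) f i (x i)).
Proof.
apply: measurable_prode => i.
exact: (measurableT_comp (@mf i) (@measurable_proj _ _ T i)).
Qed.

Let prod0 (s : seq I) (x : dprod T) : 0 <= \prod_(i <- s) f i (x i).
Proof. exact: prode_ge0. Qed.

Lemma integral_dprod_measure_seq_prod (s : seq I) : uniq s ->
  \int[dprod_measure_seq mu s]_x (\prod_(i <- s) f i (x i)) =
  \prod_(i <- s) \int[mu i]_x f i x.
Proof.
elim: s => [_|i s IH /andP[si us]].
  under eq_integral do rewrite big_nil.
  rewrite big_nil integral_cst// mul1e /=.
  by rewrite diracE mem_set.
have sf := sigma_finite_dprod_measure_seq us.
(* The sigma-finite structure is attached to the intermediate measure by hand, so that its product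
   with [mu i] is subject to Fubini. *)
pose sfin := isSFinite.Build _ _ _ _ (sfinite_measure_sigma_finite sf).
pose sgfin := isSigmaFinite.Build _ _ _ _ sf.
pose nu := HB.pack_for (SigmaFiniteMeasure.type (dprod T) R)
  (Measure.sort (dprod_measure_seq mu s)) sfin sgfin.
have -> : \int[dprod_measure_seq mu (i :: s)]_x
    (\prod_(j <- i :: s) f j (x j)) =
    \int[nu \x mu i]_p \prod_(j <- i :: s) f j (dfwith p.1 i p.2 j).
  by rewrite [LHS](@ge0_integral_pushforward _ _ _ _ _ _
    (@measurable_dfwith _ _ T i) (nu \x mu i) setT)//.
(* Overwriting coordinate [i] affects only the factor [f i], because [i] is not in [s]. *)
have dfE p : \prod_(j <- i :: s) f j (dfwith (p.1 : dprod T) i p.2 j) =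
    f i p.2 * \prod_(j <- s) f j (p.1 j).
  rewrite big_cons dfwithin; congr (_ * _); apply: eq_big_seq => j js.
  by rewrite dfwithout//; apply: contraNneq si => ->.
under eq_integral do rewrite dfE.
rewrite (fubini_tonelli1
  (fun p : dprod T * T i => f i p.2 * \prod_(j <- s) f j (p.1 j)))//.
- rewrite /fubini_F /= big_cons -IH//.
  under eq_integral do rewrite ge0_integralZr//.
  by rewrite ge0_integralZl// integral_ge0.
- apply: emeasurable_funM; first exact: measurableT_comp.
  exact: (measurableT_comp (mprod s)).
- by move=> p; rewrite mule_ge0.
Qed.

Lemma integral_dprod_measure_prod :
  \int[dprod_measure mu]_x (\prod_i f i (x i)) = \prod_i \int[mu i]_x f i x.
Proof.
under eq_integral do rewrite -big_enum/=.
by rewrite [LHS]integral_dprod_measure_seq_prod ?enum_uniq// big_enum.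
Qed.

End integral_prod.

Lemma integral_box_prod (A : forall i, set (T i)) (f : forall i, T i -> \bar R) :
    (forall i, measurable (A i)) -> (forall i, measurable_fun (A i) (f i)) ->
    (forall i x, A i x -> 0 <= f i x) ->
  \int[dprod_measure mu]_(x in box A) (\prod_i f i (x i)) =
  \prod_i \int[mu i]_(x in A i) f i x.
Proof.
move=> mA mf f0; rewrite integral_mkcond.
under [RHS]eq_bigr do rewrite integral_mkcond.
rewrite -integral_dprod_measure_prod; first last.
- by move=> i x; rewrite patchE; case: ifPn => //; rewrite in_setE => /f0.
- by move=> i; exact/(measurable_restrictT _ (mA i)).
apply: eq_integral => x _; rewrite patchE; case: ifPn => xA.
  apply: eq_bigr => i _; rewrite patchE mem_set//.
  by move: xA; rewrite in_setE; exact.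
(* Off the box some coordinate leaves its side, and the corresponding restricted factor is 0. *)
have /existsNP[i xAi] : ~ forall i, A i (x i) by move: xA; rewrite notin_setE.
by rewrite (bigD1 i)//= patchE memNset// mul0e.
Qed.

End dprod_measure_theory.

(** * The bound for two blocks of variables, pointwise and integrated *)

Lemma measurable_fun_setX_snd d1 d2 d3 (X : measurableType d1)
    (Y : measurableType d2) (Z : measurableType d3) (D : set X) (D' : set Y)
    (g : Y -> Z) : measurable D' ->
  measurable_fun D' g -> measurable_fun (D `*` D') (fun u => g u.2).
Proof.
move=> mD' mg; apply: (measurable_comp (F := D') (f := g) (g := snd)) => //.
- by move=> _ [[x y] [Dx D'y]] <-.
- exact: measurable_funTS.
Qed.

Section two_blocks.
Context d1 d2 (X : measurableType d1) (Y : measurableType d2) (R : realType).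
Variables (m1 : {sigma_finite_measure set X -> \bar R}).
Variables (m2 : {sigma_finite_measure set Y -> \bar R}).
Variables (D : set X) (D' : set Y).
Hypotheses (mD : measurable D) (mD' : measurable D').
Variables (c : X -> Y -> \bar R) (q p : Y -> \bar R).
Hypothesis mc : measurable_fun (D `*` D') (fun u => c u.1 u.2).
Hypothesis c0 : forall x y, D x -> D' y -> 0 <= c x y.
Hypotheses (dq : is_density m2 D' q) (dp : is_density m2 D' p).

Let kernel x := expeR (expect m2 D' q (fun y => lne (c x y))).

Lemma measurable_fun_expeR_expect : measurable_fun D kernel.
Proof.
have [mq _ _] := dq.
apply: measurable_fun_expeR; rewrite /expect.
apply: (measurable_fun_integral m2 mD mD' (f := fun x y => q y * lne (c x y))).
apply: emeasurable_funM; first exact: (measurable_fun_setX_snd mD' mq).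
exact: measurable_fun_lne.
Qed.

(** This is the inequality of (a) once the normalizing integral has cancelled. *)
Lemma expeR_expect_le_marginal x : KL m2 D' q p < +oo -> D x ->
  kernel x / expeR (KL m2 D' q p) <= \int[m2]_(y in D') (c x y * p y).
Proof.
move=> kloo Dx; apply: expeR_expect_le => //; last by move=> y; exact: c0.
exact: (measurable_fun_section mD mD' mc).
Qed.

(** The pointwise bound is integrated in [x], the hypothesis saying that [c x y * p y] has total
    mass 1. One order of the blocks gives R_{-i} <= 1, the other gives (b). *)
Lemma integral_expeR_expect_le :
    \int[m1]_(x in D) \int[m2]_(y in D') (c x y * p y) = 1 ->
  \int[m1]_(x in D) kernel x <= expeR (KL m2 D' q p).
Proof.
move=> cp1; have [mp p0 _] := dp.
(* An infinite divergence makes the claim trivial; this case matters for (b), where the divergence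
   may be infinite. *)
have [->|kl_neqy] := eqVneq (KL m2 D' q p) +oo; first by rewrite leey.
have kloo : KL m2 D' q p < +oo by rewrite lt_neqAle kl_neqy leey.
have kl0 : 0 <= KL m2 D' q p by exact: KL_ge0.
have kernel0 x : 0 <= kernel x by exact: expeR_ge0.
have : \int[m1]_(x in D) (kernel x / expeR (KL m2 D' q p)) <= 1.
  rewrite -cp1; apply: ge0_le_integral => //.
  - by move=> x _; rewrite mule_ge0 ?inve_ge0 ?expeR_ge0.
  - by apply: emeasurable_funM => //; exact: measurable_fun_expeR_expect.
  - apply: (measurable_fun_integral m2 mD mD' (f := fun x y => c x y * p y)).
    by apply: emeasurable_funM => //; exact: measurable_fun_setX_snd.
  - by move=> x Dx; exact: expeR_expect_le_marginal.
rewrite ge0_integralZr//; last 2 first.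
- exact: measurable_fun_expeR_expect.
- by rewrite inve_ge0 expeR_ge0.
case: (KL _ _ _ _) kloo kl0 => [k| |]// _ _.
by rewrite inver gt_eqF ?expR_gt0//= lee_pdivrMr ?expR_gt0// mul1e.
Qed.

End two_blocks.

(** It serves both for the posterior and for the updated variational factor. *)
Lemma density_normalize d (X : measurableType d) (R : realType)
    (mu : {measure set X -> \bar R}) (D : set X) (g : X -> \bar R) :
    measurable D -> measurable_fun D g -> (forall x, D x -> 0 <= g x) ->
    0 < \int[mu]_(x in D) g x < +oo ->
  is_density mu D (fun x => g x / \int[mu]_(x in D) g x).
Proof.
move=> mD mg g0 /andP[M0 Moo]; split.
- exact: emeasurable_funM.
- by move=> x Dx; rewrite mule_ge0 ?g0// inve_ge0 ltW.
- rewrite ge0_integralZr ?inve_ge0 ?ltW//.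
  move: M0 Moo; case: (\int[mu]_(x in D) g x) => [M| |]//.
  by rewrite lte_fin => M0 _; rewrite inver gt_eqF// -EFinM divff ?gt_eqF.
Qed.

(** * Splitting the parameter space into theta_i and theta_{-i} *)

Section blocks.
Context (R : realType) (I : finType) (dim : I -> nat).
Variable Theta : forall i, set (euclid R (dim i)).
Arguments Theta : clear implicits.
Hypothesis mTheta : forall i, measurable (Theta i).
Arguments mTheta : clear implicits.

(** The uncurried form is a map on a product space, along which the product measure can be pushed
    forward. *)
Definition assemble_pair i (u : euclid R (dim i) * rspace R dim i) : pspace R dim :=
  assemble u.1 u.2.

Lemma measurable_assemble i : measurable_fun setT (@assemble_pair i).
Proof.
apply: measurable_dprodP => k; rewrite /assemble_pair /assemble.
case: (i =P k) => [ik|ik]; first by case: _ / ik; exact: measurable_fst.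
exact: (measurableT_comp (@measurable_proj _ _
  (fun j : others i => euclid R (dim (val j))) (Sub k (neq_sym_negb ik)))
  measurable_snd).
Qed.

HB.instance Definition _ i :=
  isMeasurableFun.Build _ _ _ _ (@assemble_pair i) (@measurable_assemble i).

Lemma preimage_assemble_box i (A : forall k, set (euclid R (dim k))) :
  @assemble_pair i @^-1` box A = A i `*` box (fun j : others i => A (val j)).
Proof.
apply/seteqP; split => [[x z] /= Axz|[x z] /= [Ax Az] k].
  split; first by have := Axz i; rewrite /assemble_pair assemble_in.
  move=> j; have := Axz (val j).
  rewrite /assemble_pair /= -[z in X in _ -> X](rest_assemble x).
  exact.
rewrite /assemble_pair /assemble; case: eqP => [ik|ik]; first by case: _ / ik.
exact: (Az (Sub k (neq_sym_negb ik))).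
Qed.

Lemma box_assemble i x (z : rspace R dim i) : Theta i x -> rTheta Theta i z ->
  box Theta (assemble x z).
Proof.
move=> Tx Tz; rewrite -[_ (assemble _ _)]/((@assemble_pair i @^-1` _) (x, z)).
by rewrite preimage_assemble_box.
Qed.

(** By uniqueness it suffices to compare boxes, where the factor of index [i] splits off the product
    of side volumes. *)
Lemma pleb_pushforward i (B : set (pspace R dim)) : measurable B ->
  pleb R dim B =
  pushforward (leb R (dim i) \x rleb R dim i) (@assemble_pair i) B.
Proof.
apply: dprod_measure_unique => A mA.
rewrite /= /pushforward preimage_assemble_box product_measure1E//; last first.
  exact: measurable_box.
rewrite [X in _ * X]dprod_measure_box// (bigD1 i)//=; congr (_ * _).
by rewrite (big_sub (fun j => j != i)).
Qed.

Lemma measurable_rTheta i : measurable (rTheta Theta i).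
Proof. exact: measurable_box. Qed.

(** Change of variables along [assemble_pair], followed by Tonelli. *)
Lemma integral_assemble i (f : pspace R dim -> \bar R) :
    measurable_fun (box Theta) f -> (forall t, box Theta t -> 0 <= f t) ->
  \int[pleb R dim]_(t in box Theta) f t =
  \int[leb R (dim i)]_(x in Theta i)
    \int[rleb R dim i]_(z in rTheta Theta i) f (assemble x z).
Proof.
move=> mf f0; have mbox := measurable_box mTheta.
rewrite (eq_measure_integral
    (pushforward (leb R (dim i) \x rleb R dim i) (@assemble_pair i)));
  last by move=> A mA _; exact: pleb_pushforward.
rewrite ge0_integral_pushforward//; last by move=> t; rewrite in_setE; exact: f0.
rewrite preimage_assemble_box -(integral_prod1 _ _ (mTheta i) (@measurable_rTheta i)
  (f := fun x z => f (assemble x z)))//.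
- apply: (measurable_comp (F := box Theta) (f := f) (g := @assemble_pair i)) => //.
    by move=> _ [u [Tu1 Tu2] <-]; exact: box_assemble.
  exact: measurable_funTS (@measurable_assemble i).
- by move=> x z Tx Tz; apply/f0/box_assemble.
Qed.

Lemma measurable_fun_split i (g : euclid R (dim i) -> rspace R dim i -> \bar R) :
    measurable_fun (Theta i `*` rTheta Theta i) (fun u => g u.1 u.2) ->
  measurable_fun (box Theta) (fun t => g (t i) (rest t)).
Proof.
move=> mg.
apply: (measurable_comp (F := Theta i `*` rTheta Theta i)
  (f := fun u => g u.1 u.2) (g := fun t : pspace R dim => (t i, rest t))) => //.
- exact: measurableX (@measurable_rTheta i).
- by move=> _ [t Tt <-]; split => // j; exact: Tt.
- apply: measurable_funTS; apply: measurable_fun_pair.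
    exact: measurable_proj.
  by apply: measurable_dprodP => j; exact: measurable_proj.
Qed.

(** The integral of a product of factors over a box is the product of their integrals, each equal to
    1. *)
Lemma rfactors_density (q : forall i, euclid R (dim i) -> \bar R) i :
  mean_field Theta q -> is_density (rleb R dim i) (rTheta Theta i) (rfactors q i).
Proof.
move=> mfq; split.
- apply: measurable_prode => j.
  apply: (measurable_comp (F := Theta (val j)) (f := q (val j))
    (g := fun z : rspace R dim i => z j)) => //.
  + exact: mTheta.
  + by move=> _ [z Tz <-]; exact: Tz.
  + by have [] := mfq (val j).
  + by apply: measurable_funTS; exact: measurable_proj.
- by move=> z Tz; apply: prode_ge0 => j _; have [_ + _] := mfq (val j); apply; exact: Tz.
- rewrite [LHS]integral_box_prod//.
  + by rewrite big1// => j _; have [] := mfq (val j).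
  + by move=> j; have [] := mfq (val j).
  + by move=> j x; have [_ + _] := mfq (val j); exact.
Qed.

Section posterior_density.
Variable post : pspace R dim -> \bar R.
Hypothesis dpost : is_density (pleb R dim) (box Theta) post.

(** An almost everywhere factorization already fixes the total mass. Both versions of the
    conditionals are treated this way, with [g] the conditional times the matching marginal. *)
Lemma integral_split_posterior i (g : euclid R (dim i) -> rspace R dim i -> \bar R) :
    measurable_fun (Theta i `*` rTheta Theta i) (fun u => g u.1 u.2) ->
    (forall x z, Theta i x -> rTheta Theta i z -> 0 <= g x z) ->
    {ae pleb R dim, forall t, box Theta t -> post t = g (t i) (rest t)} ->
  \int[leb R (dim i)]_(x in Theta i)
    \int[rleb R dim i]_(z in rTheta Theta i) g x z = 1.
Proof.
move=> mg g0 postg; have [mpost post0 post1] := dpost.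
have mgs := measurable_fun_split mg.
have gs0 t : box Theta t -> 0 <= g (t i) (rest t).
  by move=> Tt; apply: g0 => // j; exact: Tt.
rewrite -post1 (ge0_ae_eq_integral _ mpost mgs post0 gs0)//; last exact: measurable_box.
rewrite (integral_assemble i mgs gs0); apply: eq_integral => x _.
by apply: eq_integral => z _; rewrite assemble_in rest_assemble.
Qed.

Lemma rmarginal_density i :
  is_density (rleb R dim i) (rTheta Theta i) (rmarginal Theta post i).
Proof.
have [mpost post0 post1] := dpost.
have masm : measurable_fun (Theta i `*` rTheta Theta i)
    (fun u => post (assemble u.1 u.2)).
  apply: (measurable_comp (F := box Theta) (f := post) (g := @assemble_pair i)) => //.
  - exact: measurable_box.
  - by move=> _ [u [Tu1 Tu2] <-]; exact: box_assemble.
  - exact: measurable_funTS (@measurable_assemble i).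
have asm0 x z : Theta i x -> rTheta Theta i z -> 0 <= post (assemble x z).
  by move=> Tx Tz; apply/post0/box_assemble.
split.
- apply: (measurable_fun_integral _ (@measurable_rTheta i) (mTheta i)
    (f := fun z x => post (assemble x z))).
  exact: (measurable_fun_uncurry_swap (mTheta i) (@measurable_rTheta i)
    (f := fun x z => post (assemble x z)) masm).
- by move=> z Tz; apply: integral_ge0 => x Tx; exact: asm0.
(* The marginal integrates over theta_i first, whereas [integral_assemble] puts that integral
   outside; Tonelli exchanges them. *)
- rewrite -post1 (integral_assemble i mpost post0) /rmarginal.
  by rewrite (exchange_integral_setX _ _ (mTheta i) (@measurable_rTheta i)
    (f := fun x z => post (assemble x z)) masm).
Qed.

Variables (i : I) (c : euclid R (dim i) -> rspace R dim i -> \bar R).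
Hypothesis condc : is_cond Theta post i c.

Let measurable_cond_rmarginal : measurable_fun (Theta i `*` rTheta Theta i)
  (fun u => c u.1 u.2 * rmarginal Theta post i u.2).
Proof.
have [mc _ _] := condc; have [mrm _ _] := rmarginal_density i.
apply: emeasurable_funM; first exact: mc.
exact: (measurable_fun_setX_snd (@measurable_rTheta i) mrm).
Qed.

Let cond_rmarginal_ge0 x z : Theta i x -> rTheta Theta i z ->
  0 <= c x z * rmarginal Theta post i z.
Proof.
have [_ c0 _] := condc; have [_ rm0 _] := rmarginal_density i.
by move=> Tx Tz; rewrite mule_ge0 ?c0 ?rm0.
Qed.

(** Unfolding [marginal] gives the mass hypothesis of [integral_expeR_expect_le] for (a). *)
Lemma integral_marginal :
  \int[leb R (dim i)]_(x in Theta i) marginal Theta post i c x = 1.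
Proof. by have [_ _ ae_c] := condc; exact: integral_split_posterior. Qed.

Lemma marginal_density :
  is_density (leb R (dim i)) (Theta i) (marginal Theta post i c).
Proof.
split; last exact: integral_marginal.
- exact: (measurable_fun_integral _ (mTheta i) (@measurable_rTheta i)
    (f := fun x z => c x z * rmarginal Theta post i z)).
- by move=> x Tx; apply: integral_ge0 => z Tz; exact: cond_rmarginal_ge0.
Qed.

(** The same mass hypothesis with the blocks exchanged, as (b) requires. *)
Lemma integral_rcond_marginal r : is_rcond Theta post i c r ->
  \int[rleb R dim i]_(z in rTheta Theta i)
    \int[leb R (dim i)]_(x in Theta i) (r x z * marginal Theta post i c x) = 1.
Proof.
move=> [mr r0 ae_r]; have [mm m0 _] := marginal_density.
have mrm : measurable_fun (Theta i `*` rTheta Theta i)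
    (fun u => r u.1 u.2 * marginal Theta post i c u.1).
  apply: emeasurable_funM; first exact: mr.
  apply: (measurable_fun_uncurry_swap (@measurable_rTheta i) (mTheta i)
    (f := fun _ x => marginal Theta post i c x)).
  exact: (measurable_fun_setX_snd (mTheta i) mm).
have rm0 x z : Theta i x -> rTheta Theta i z -> 0 <= r x z * marginal Theta post i c x.
  by move=> Tx Tz; rewrite mule_ge0 ?r0 ?m0.
rewrite -(exchange_integral_setX _ _ (mTheta i) (@measurable_rTheta i) mrm)//.
exact: integral_split_posterior.
Qed.

End posterior_density.

(** Only factor [i] changes, and [cavi_wf] makes its normalizing integral positive and finite. *)
Lemma cavi_update_mean_field post c i q :
    (forall j, is_cond Theta post j (c j)) -> mean_field Theta q ->
    cavi_wf Theta post c i (rfactors q i) ->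
  mean_field Theta (cavi_update Theta c i q).
Proof.
move=> condc mfq [_ _ norm] j; rewrite /cavi_update.
have [ij|ij] := eqVneq i j; last by rewrite dfwithout.
case: _ / ij; rewrite dfwithin; apply: density_normalize => //.
- have [mc c0 _] := condc i.
  exact: (measurable_fun_expeR_expect (mTheta i) (@measurable_rTheta i) mc
    (rfactors_density i mfq)).
- by move=> x _; exact: expeR_ge0.
Qed.

End blocks.

(** * The posterior density and the CAVI run *)

Lemma posterior_density (R : realType) (I : finType) (dim : I -> nat)
    (Theta : forall i, set (euclid R (dim i))) (n : nat)
    (lik : euclid R n -> pspace R dim -> \bar R)
    (prior : pspace R dim -> \bar R) (y : euclid R n) :
    (forall i, measurable (Theta i)) -> bayes_model Theta lik prior y ->
  is_density (pleb R dim) (box Theta) (posterior Theta (lik y) prior).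
Proof.
move=> mTheta [dlik mlik mprior prior0 ev].
apply: density_normalize => //.
- exact: measurable_box.
- exact: emeasurable_funM.
- by move=> t Tt; rewrite mule_ge0 ?prior0//; have [_ + _] := dlik t Tt; apply.
Qed.

Theorem corollary6p1 (R : realType) (K : nat) (dim : 'I_K -> nat)
    (Theta : forall i : 'I_K, set (euclid R (dim i)))
    (n : nat) (lik : euclid R n -> pspace R dim -> \bar R)
    (prior : pspace R dim -> \bar R) (y : euclid R n)
    (c r : forall i : 'I_K, euclid R (dim i) -> rspace R dim i -> \bar R)
    (q : nat -> forall i : 'I_K, euclid R (dim i) -> \bar R) :
  let post := posterior Theta (lik y) prior in
  (1 < K)%N ->
  (forall i, measurable (Theta i)) ->
  bayes_model Theta lik prior y ->
  (forall i, is_cond Theta post i (c i)) ->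
  (forall i, is_rcond Theta post i (c i) (r i)) ->
  cavi_run Theta c q ->
  forall (t : nat) (i : 'I_K), i = (t %% K)%N :> nat ->
  (forall (s : nat) (j : 'I_K), (s <= t)%N -> j = (s %% K)%N :> nat ->
     cavi_wf Theta post c j (rfactors (q s) j)) ->
  let Rq := Rfun Theta post c i (rfactors (q t) i) in
  let qi := q t.+1 i in
  let pi_i := marginal Theta post i (c i) in
  [/\ 0 < Rq <= 1,
      (forall x, Theta i x -> Rq * qi x <= pi_i x) &
      (forall z, rTheta Theta i z ->
         expect_defined (leb R (dim i)) (Theta i) qi
           (fun x => lne (r i x z))) ->
      maxe 0 (lne (\int[rleb R dim i]_(z in rTheta Theta i)
                expeR (expect (leb R (dim i)) (Theta i) qi
                  (fun x => lne (r i x z)))))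
        <= KL (leb R (dim i)) (Theta i) qi pi_i].
Proof.
move=> post _ mTheta bayes condc condr [mf0 upd] t i it wf Rq qi pi_i.
have dpost : is_density (pleb R dim) (box Theta) post by exact: posterior_density.
(* Induction along the run: well-formedness of every step up to [t] keeps the factors densities,
   including those after update [t]. *)
have mfq s : (s <= t.+1)%N -> mean_field Theta (q s).
  elim: s => [//|s IH] st.
  pose j : 'I_K := Ordinal (ltn_pmod s (leq_ltn_trans (leq0n i) (ltn_ord i))).
  rewrite (upd s j)//; apply: cavi_update_mean_field (IH _) (wf s j _ _) => //.
  exact: ltnW.
have qiE : qi = fun x => cavi_kernel Theta c i (rfactors (q t) i) x /
    cavi_norm Theta c i (rfactors (q t) i).
  by rewrite /qi (upd t i it) /cavi_update dfwithin.
have dqi : is_density (leb R (dim i)) (Theta i) qi by exact: mfq.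
have [_ kloo /andP[norm0 normoo]] := wf t i (leqnn t) it.
have [mc c0 _] := condc i; have [mr r0 _] := condr i.
have mrT : measurable (rTheta Theta i) by exact: measurable_rTheta.
have dqr : is_density (rleb R dim i) (rTheta Theta i) (rfactors (q t) i).
  exact/rfactors_density/mfq.
have drm := rmarginal_density mTheta dpost i.
have dpi : is_density (leb R (dim i)) (Theta i) pi_i by exact: marginal_density.
have kl0 : 0 <= KL (rleb R dim i) (rTheta Theta i) (rfactors (q t) i)
    (rmarginal Theta post i) by exact: KL_ge0.
(* The divergence is finite and nonnegative, so the denominator of [Rq] is a positive real [k]. *)
have [k k0 kE] : exists2 k, (0 < k)%R & expeR (KL (rleb R dim i) (rTheta Theta i)
    (rfactors (q t) i) (rmarginal Theta post i)) = k%:E.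
  case: (KL _ _ _ _) kl0 kloo => [k| |]// _ _.
  by exists (expR k); rewrite ?expR_gt0.
split.
- have := integral_expeR_expect_le (mTheta i) mrT mc c0 dqr drm
    (integral_marginal mTheta dpost (condc i)).
  rewrite -/(cavi_norm Theta c i _) /Rq /Rfun kE inver gt_eqF// => normk.
  by rewrite lee_pdivrMr// mul1e normk andbT mule_gt0// lte_fin invr_gt0.
- move=> x Tx.
  have := expeR_expect_le_marginal (mTheta i) mrT mc c0 dqr drm kloo Tx.
  apply: le_trans; rewrite /Rq /Rfun qiE kE.
  rewrite -/(cavi_kernel Theta c i (rfactors (q t) i) x).
  (* The normalizing integral [M] cancels between [Rq] and [qi x], leaving the kernel divided by
     [k]. *)
  move: norm0 normoo; case: (cavi_norm _ _ _ _) => [M| |]// M0 _.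
  rewrite muleCA muleAC inver gt_eqF// -EFinM divff ?gt_eqF// mul1e.
  by rewrite muleC.
- move=> _.
  (* For (b) the blocks are exchanged: the expectation is over theta_i under [qi], and theta_{-i}
     becomes the outer variable. *)
  have mr' := measurable_fun_uncurry_swap (mTheta i) mrT mr.
  have := integral_expeR_expect_le mrT (mTheta i) mr'
    (fun z x Tz Tx => r0 x z Tx Tz) dqi dpi
    (integral_rcond_marginal mTheta dpost (condc i) (condr i)).
  (* The bound by 0 is Gibbs' inequality; the other follows by taking [lne] of the integrated bound,
     with the divergence written as [lne] of its exponential. *)
  rewrite ge_max KL_ge0//= -{2}(expeRK (KL _ _ _ _)) => le_norm.
  rewrite lee_lne// in_itv /= leey andbT ?expeR_ge0//.
  by apply: integral_ge0 => z _; exact: expeR_ge0.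
Qed.
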